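(* Let $T$ be a closed normal operator on a complex Hilbert space $H$ and let $A$ be a linear operator on $H$ with $\mathcal D(T)\subseteq\mathcal D(A)$ such that, for some constants $a\ge 0$ and $0\le b<1$, $\|Ax\|^2\le a^2\|x\|^2+b^2\|Tx\|^2$ for all $x\in\mathcal D(T)$. Assume that there are real $\gamma_1<\gamma_2$ with $\sigma(T)\subseteq\{z\in\mathbb C:\gamma_1\le\operatorname{Im} z\le\gamma_2\}$, and that there are real $\alpha_T<\beta_T$ with $\{z\in\mathbb C:\alpha_T<\operatorname{Re} z<\beta_T\}\subseteq\rho(T)$. Set $\widetilde\gamma=\max\{|\gamma_1|,|\gamma_2|\}$ and $$\alpha'_{T+A}=\alpha_T+\sqrt{a^2+b^2\widetilde\gamma^2+b^2\alpha_T^2},\qquad \beta'_{T+A}=\beta_T-\sqrt{a^2+b^2\widetilde\gamma^2+b^2\beta_T^2}.$$ If $\alpha'_{T+A}<\beta'_{T+A}$, then $$\{z\in\mathbb C:\alpha'_{T+A}<\operatorname{Re} z<\beta'_{T+A}\}\subseteq\rho(T+A).$$ Moreover, if $\alpha'_{T+A}<\operatorname{Re} z<\beta'_{T+A}$, then $$\|(T+A-z)^{-1}\|\le\frac{\Big(\sqrt{(\min\{\operatorname{Re} z-\alpha_T,\beta_T-\operatorname{Re} z\})^2+(\min\{0,\gamma_2-\operatorname{Im} z,\operatorname{Im} z-\gamma_1\})^2}\Big)^{-1}}{1-\max\Big\{b,\ \frac{\sqrt{a^2+b^2\widetilde\gamma^2+b^2\alpha_T^2}}{\operatorname{Re} z-\alpha_T},\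 \frac{\sqrt{a^2+b^2\widetilde\gamma^2+b^2\beta_T^2}}{\beta_T-\operatorname{Re} z}\Big\}}.$$
   Context: $\mathcal D(S)$ denotes the domain of an operator $S$. A closed densely defined operator $T$ on $H$ is normal if $TT^*=T^*T$. The operator $T+A$ has domain $\mathcal D(T)$. The resolvent set $\rho(S)$ is the set of $z\in\mathbb C$ such that $S-z:\mathcal D(S)\to H$ is bijective with bounded inverse; $\sigma(S)=\mathbb C\setminus\rho(S)$. *)

(* Defs.v *)
From HB Require Import structures.
From mathcomp Require Import all_boot all_order all_algebra.
From mathcomp Require Export sesquilinear complex.
From mathcomp Require Import all_classical all_reals ereal.
From mathcomp Require Import topology normedtype.

Set Implicit Arguments.
Unset Strict Implicit.
Unset Printing Implicit Defensive.

Import Order.TTheory GRing.Theory Num.Theory Num.Def.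
Import numFieldNormedType.Exports.
Import ComplexField.

Local Open Scope classical_set_scope.
Local Open Scope ring_scope.
Local Open Scope complex_scope.

(* The inner product is linear in its first argument. *)
HB.mixin Record isHilbert (R : realType) H
    of CompleteNormedModule R[i] H := {
  inner : {dot H for (@conjC R[i])} ;
  inner_norm : forall x : H, inner x x = `|x| ^+ 2
}.

#[short(type="hilbertType")]
HB.structure Definition Hilbert (R : realType) :=
  { H of isHilbert R H & CompleteNormedModule R[i] H }.

Section operators.
Context {R : realType} {H : hilbertType R}.

(* In a normed module over R[i] the norm takes (real) values in R[i]. *)
Definition hnorm (x : H) : R := complex.Re `|x|.

(* The values of [app] outside [dom] carry no meaning, so operators are
   compared with [op_eq] rather than with Leibniz equality. *)
Record operator := Operator { dom : set H ; app :> H -> H }.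

Definition linear_operator (S : operator) : Prop :=
  [/\ dom S 0,
      forall (c : R[i]) (x y : H),
        dom S x -> dom S y -> dom S (c *: x + y) &
      forall (c : R[i]) (x y : H),
        dom S x -> dom S y -> S (c *: x + y) = c *: S x + S y].

Definition op_eq (S T : operator) : Prop :=
  dom S = dom T /\ forall x, dom S x -> S x = T x.

Definition op_add (S T : operator) : operator :=
  Operator (dom S `&` dom T) (fun x => S x + T x).

Lemma dom_op_add (S T : operator) :
  dom S `<=` dom T -> dom (op_add S T) = dom S.
Proof. exact: setIidl. Qed.

Definition op_comp (S T : operator) : operator :=
  Operator [set x | dom T x /\ dom S (T x)] (fun x => S (T x)).

Definition closed_operator (S : operator) : Prop :=
  closed [set p : H * H | dom S p.1 /\ p.2 = S p.1].

Definition densely_defined (S : operator) : Prop := dense (dom S).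

Definition adjoint_value (S : operator) (y : H) : set H :=
  [set w | forall x, dom S x -> inner (S x) y = inner x w].

(* If [S] is densely defined, [adjoint_value S y] has at most one element. *)
Definition adjoint (S : operator) : operator :=
  Operator [set y | adjoint_value S y !=set0]
           (fun y => get (adjoint_value S y)).

Definition normal_operator (T : operator) : Prop :=
  [/\ linear_operator T, closed_operator T, densely_defined T &
      op_eq (op_comp T (adjoint T)) (op_comp (adjoint T) T)].

Definition op_shift (S : operator) (z : R[i]) (x : H) : H := S x - z *: x.

(* [(S - z)^-1], meaningful when [S - z] is a bijection from [dom S] to [H]. *)
Definition resolvent (S : operator) (z : R[i]) : H -> H :=
  pinv (dom S) (op_shift S z).

Definition bounded_map (B : H -> H) : Prop :=
  exists M : R, forall x, hnorm (B x) <= M * hnorm x.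

Definition opnorm (B : H -> H) : \bar R :=
  ereal_sup [set (hnorm (B x))%:E | x in [set x | hnorm x <= 1]].

Definition resolvent_set (S : operator) : set R[i] :=
  [set z | set_bij (dom S) setT (op_shift S z) /\ bounded_map (resolvent S z)].

Definition spectrum (S : operator) : set R[i] := ~` resolvent_set S.

End operators.
Arguments operator {R} H.

(* Main.v *)
Require Import Defs.
From mathcomp Require Import all_boot all_order all_algebra.
From mathcomp Require Import all_classical all_reals ereal.
From mathcomp Require Import topology normedtype sequences.
From mathcomp Require Import ring lra.

(** Write S = T - z and suppose z is a resolvent point of T. If
    |A x| <= c |S x| with c < 1 and |S x| >= d |x| with d > 0, then
    S + A = (1 + A S^-1) S is a bijection and its inverse has norm at most
    1 / (d (1 - c)) ([resolvent_set_perturb]). So the theorem asks for two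
    lower bounds of |S x|, with the constants of a scalar computation on the
    spectrum. Both come from one fact about normal operators,
    [normal_bounded_below]: if the open disc of centre w and radius r contains
    no spectrum, then |(T - w) x| >= r |x|. It gives the bound by d with w = z.
    For the bound of A, let C > b^2. Completing the square writes
      C |(T - z) x|^2 - b^2 |T x|^2 - a^2 |x|^2
    as (C - b^2) (|(T - w) x|^2 - r^2 |x|^2) for suitable w and r^2, and the
    same identity with a scalar l in place of T shows that the disc of centre
    w and radius r avoids the spectrum as soon as
    a^2 + b^2 |l|^2 <= C |l - z|^2 for each spectral point l
    ([normal_quadratic_bound]). The last inequality, with C = c^2, is
    Minkowski's inequality in the plane ([weighted_modulus_le]).

    The lower bound by the distance to the spectrum is proved without the
    spectral theorem. The only trace of normality it uses is the log-convexity
      |S v|^2 <= |v| |S (S v)|,   S = T - w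
    ([normal_shift_sqr]). This would be immediate if |S* y| = |S y| were known
    on all of D(T), but T T* = T* T says so only on D(T* T). The operators
    (1 + e T* T)^-1 are contractions, commute with T, have values in D(T* T)
    and tend to the identity as e tends to 0, so they carry the inequality over
    from D(T* T). They are obtained by minimizing e |T x|^2 + |x - f|^2
    over D(T), which takes only the closedness of T.

    Now let m be the best constant with |S x| >= m |x|, and assume that m < r.
    Then U = m S^-1 is a contraction of norm 1, and log-convexity lets the
    norms of U^k y, k < K, stay as close to |y| as one likes for suitable y. For
    h_v = sum_(k < K) v^k U^k y with v a K-th root of unity, Parseval's
    identity gives some v with |h_v|^2 at least about K |y|^2 / 2, whereas
    (1 - v U) h_v = y - U^K y has norm at most 2 |y|. Hence T - (w + v m) has
    no uniform lower bound on the circle of radius m around w. But this circle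
    is a compact set of resolvent points ([circle_bounded_below]), which is a
    contradiction. *)

Set Implicit Arguments.
Unset Strict Implicit.
Unset Printing Implicit Defensive.

Import Order.TTheory GRing.Theory Num.Theory.
Import numFieldNormedType.Exports.
Local Open Scope classical_set_scope.
Local Open Scope ring_scope.

(** * The real inner product of a complex Hilbert space *)

Section real_inner_product.
Local Open Scope complex_scope.
Context {R : realType} {H : hilbertType R}.
Implicit Types (x y z : H) (c : R[i]) (r : R).

(** Taking real parts gives a symmetric form, bilinear over the reals, which
    still determines the norm and, for linear operators, the adjoint
    ([adjoint_valueP]). *)
Definition ip x y : R := complex.Re (inner x y).

Lemma hnormE x : `|x| = (hnorm x)%:C.
Proof. by rewrite /hnorm RRe_real // ger0_real. Qed.

Lemma hnorm_ge0 x : 0 <= hnorm x.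
Proof. by rewrite -ler0c -hnormE. Qed.

Lemma hnorm_sqr x : hnorm x ^+ 2 = ip x x.
Proof. by rewrite /ip inner_norm hnormE -rmorphXn. Qed.

Lemma ler_hnormD x y : hnorm (x + y) <= hnorm x + hnorm y.
Proof. by rewrite -lecR rmorphD /= -!hnormE ler_normD. Qed.

Lemma hnorm_opp x : hnorm (- x) = hnorm x.
Proof. by rewrite /hnorm normrN. Qed.

Lemma hnorm_distC x y : hnorm (x - y) = hnorm (y - x).
Proof. by rewrite -hnorm_opp opprB. Qed.

Lemma hnorm0 : hnorm (0 : H) = 0.
Proof. by rewrite /hnorm normr0. Qed.

Lemma hnorm_eq0 x : hnorm x = 0 -> x = 0.
Proof. by move=> x0; apply/eqP; rewrite -normr_eq0 hnormE x0. Qed.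

Lemma ler_hnorm_sub x y : hnorm (x - y) <= hnorm x + hnorm y.
Proof. by rewrite -(hnorm_opp y) ler_hnormD. Qed.

Lemma ipC x y : ip x y = ip y x.
Proof.
rewrite /ip hermC /= expr0 mul1r.
by case: (inner y x).
Qed.

Lemma ipDl x y z : ip (x + y) z = ip x z + ip y z.
Proof.
have ReD (s t : R[i]) : complex.Re (s + t) = complex.Re s + complex.Re t.
  by case: s t => [? ?] [? ?].
by rewrite /ip linearDl; exact: ReD.
Qed.

Lemma ipDr x y z : ip z (x + y) = ip z x + ip z y.
Proof. by rewrite ipC ipDl !(ipC z). Qed.

Lemma ip0l x : ip 0 x = 0.
Proof. by apply: (@addrI _ (ip 0 x)); rewrite -ipDl !addr0. Qed.

Lemma ipNl x z : ip (- x) z = - ip x z.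
Proof. by apply/eqP; rewrite -addr_eq0 -ipDl addNr ip0l. Qed.

Lemma ipNr x z : ip z (- x) = - ip z x.
Proof. by rewrite ipC ipNl ipC. Qed.

Lemma ipZl r x z : ip (r%:C *: x) z = r * ip x z.
Proof.
have ReM (t : R[i]) : complex.Re (r%:C * t) = r * complex.Re t.
  by case: t => u v /=; rewrite mul0r subr0.
by rewrite /ip linearZl_LR; exact: ReM.
Qed.

Lemma ipZr r x z : ip z (r%:C *: x) = r * ip z x.
Proof. by rewrite ipC ipZl ipC. Qed.

Lemma ipZlJ c x y : ip (c *: x) y = ip x (c^* *: y).
Proof.
rewrite /ip linearZl_LR linearZr_LR /=.
have JK : Num.Def.conjC c^* = c := conjcK c.
by rewrite JK.
Qed.

Lemma ipZZ c x : ip (c *: x) (c *: x) =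
  (complex.Re c ^+ 2 + complex.Im c ^+ 2) * ip x x.
Proof.
rewrite ipZlJ scalerA.
have -> : c^* * c = (complex.Re c ^+ 2 + complex.Im c ^+ 2)%:C.
  by case: c => u v; apply/eqP; rewrite eq_complex /=; apply/andP; split;
    apply/eqP; ring.
by rewrite ipZr.
Qed.

Lemma hnormZ_sqr c x : hnorm (c *: x) ^+ 2 =
  (complex.Re c ^+ 2 + complex.Im c ^+ 2) * hnorm x ^+ 2.
Proof. by rewrite !hnorm_sqr ipZZ. Qed.

Lemma hnormZ c x : hnorm (c *: x) =
  Num.sqrt (complex.Re c ^+ 2 + complex.Im c ^+ 2) * hnorm x.
Proof.
apply/eqP; rewrite -(eqrXn2 (n := 2)) ?mulr_ge0 ?hnorm_ge0 ?sqrtr_ge0 //.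
by rewrite hnormZ_sqr exprMn sqr_sqrtr // addr_ge0 ?sqr_ge0.
Qed.

Lemma hnormZr r x : hnorm (r%:C *: x) = `|r| * hnorm x.
Proof. by rewrite hnormZ /= expr0n addr0 sqrtr_sqr. Qed.

Lemma hnorm_sqrD x y :
  hnorm (x + y) ^+ 2 = hnorm x ^+ 2 + 2 * ip x y + hnorm y ^+ 2.
Proof. by rewrite !hnorm_sqr !(ipDl, ipDr) (ipC y x); ring. Qed.

Lemma hnorm_sqrB x y :
  hnorm (x - y) ^+ 2 = hnorm x ^+ 2 - 2 * ip x y + hnorm y ^+ 2.
Proof. by rewrite hnorm_sqrD ipNr hnorm_opp; ring. Qed.

(** Cauchy-Schwarz read off the triangle inequality: compare
    |x + y|^2 with (|x| + |y|)^2. *)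
Lemma ip_le x y : ip x y <= hnorm x * hnorm y.
Proof.
have : hnorm (x + y) ^+ 2 <= (hnorm x + hnorm y) ^+ 2.
  by rewrite ler_pXn2r ?ler_hnormD // nnegrE ?addr_ge0 ?hnorm_ge0.
by rewrite hnorm_sqrD; lra.
Qed.

End real_inner_product.

(** * Convergence, closed graphs and density in terms of the norm *)

Section topology_to_norm.
Local Open Scope complex_scope.
Context {R : realType} {H : hilbertType R}.

Lemma ball_hnorm (x y : H) (e : R) : ball x e%:C y <-> hnorm (x - y) < e.
Proof. by rewrite -ball_normE /ball_ /= hnormE ltcR. Qed.

Lemma nbhs_hnorm (x : H) (P : set H) :
  nbhs x P <-> exists2 e : R, 0 < e & forall y, hnorm (x - y) < e -> P y.
Proof.
split.
  move=> /nbhs_ballP[[e f]] /=; rewrite ltcE /= => /andP[/eqP-> e0] eP.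
  by exists e => // y /ball_hnorm; exact: eP.
move=> [e e0 eP]; apply/nbhs_ballP; exists e%:C; first by rewrite /= ltcR.
by move=> y /ball_hnorm; exact: eP.
Qed.

Definition hcvg (u : nat -> H) (l : H) :=
  forall e : R, 0 < e -> exists N, forall n, (N <= n)%N -> hnorm (u n - l) < e.

Definition hcauchy (u : nat -> H) := forall e : R, 0 < e ->
  exists N, forall m n, (N <= m)%N -> (N <= n)%N -> hnorm (u m - u n) < e.

Lemma hcvg_cvg (u : nat -> H) l : hcvg u l <-> u @ \oo --> l.
Proof.
split.
  move=> ul P /nbhs_hnorm[e e0 eP]; have [N uN] := ul _ e0.
  by exists N => // n /= Nn; apply: eP; rewrite hnorm_distC; exact: uN.
move=> ul e e0.
have : nbhs l [set y | hnorm (l - y) < e] by apply/nbhs_hnorm; exists e.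
move=> /ul[N _ NP]; exists N => n Nn.
by rewrite hnorm_distC; exact: NP.
Qed.

Lemma hcomplete (u : nat -> H) : hcauchy u -> exists l, hcvg u l.
Proof.
move=> uC.
suff /cauchy_cvgP/cvg_ex[l ul] : cauchy (u @ \oo) by exists l; apply/hcvg_cvg.
apply: cauchy_exP => -[e f]; rewrite ltcE /= => /andP[/eqP-> e0].
have [N uN] := uC _ e0; exists (u N); exists N => // n /= Nn.
by apply/ball_hnorm; exact: uN.
Qed.

Lemma closed_operatorP (S : operator H) (u : nat -> H) x y : closed_operator S
  ->
  (forall n, dom S (u n)) -> hcvg u x -> hcvg (S \o u) y -> dom S x /\ S x = y.
Proof.
move=> cS uS /hcvg_cvg ux /hcvg_cvg uy.
have [] : dom S (x, y).1 /\ (x, y).2 = S (x, y).1; last by move=> /= ? ->.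
apply: cS => B [[P Q] /= [/ux[M _ MP] /uy[N _ NQ]] PQB].
pose n := maxn M N; exists (u n, S (u n)); split; first by split=> /=.
apply: (PQB (_, _)); split => /=.
- by apply: MP; rewrite /= leq_maxl.
- by apply: NQ; rewrite /= leq_maxr.
Qed.

Lemma densely_definedP (S : operator H) x (e : R) : densely_defined S -> 0 < e
  ->
  exists2 y, dom S y & hnorm (x - y) < e.
Proof.
move=> dS e0; have [||y [By Sy]] := dS [set y | hnorm (x - y) < e].
- by exists x; rewrite /= subrr hnorm0.
- rewrite openE => y /= xy; apply/nbhs_hnorm.
  exists (e - hnorm (x - y)); first by rewrite subr_gt0.
  move=> z yz /=.
  have -> : x - z = (x - y) + (y - z) by rewrite addrA subrK.
  by apply: le_lt_trans (ler_hnormD _ _) _; lra.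
by exists y.
Qed.

End topology_to_norm.

(** * Linear operators and their adjoints *)

Section linear_operators.
Local Open Scope complex_scope.
Context {R : realType} {H : hilbertType R}.
Variable S : operator H.
Hypothesis linS : linear_operator S.
Implicit Types (x y : H) (c : R[i]).

Lemma lin_dom0 : dom S 0. Proof. by case: linS. Qed.

Lemma lin_app0 : S 0 = 0.
Proof.
case: linS => S0 _ /(_ 1 0 0 S0 S0).
by rewrite !scale1r addr0 -[LHS]addr0 => /addrI.
Qed.

Lemma lin_domZ c x : dom S x -> dom S (c *: x).
Proof.
by move=> Sx; case: linS => S0 /(_ c x 0 Sx S0) + _; rewrite addr0.
Qed.

Lemma lin_appZ c x : dom S x -> S (c *: x) = c *: S x.
Proof.
move=> Sx; case: linS => S0 _ /(_ c x 0 Sx S0).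
by rewrite lin_app0 !addr0.
Qed.

Lemma lin_domD x y : dom S x -> dom S y -> dom S (x + y).
Proof.
by move=> Sx Sy; case: linS => S0 /(_ 1 x y Sx Sy) + _; rewrite scale1r.
Qed.

Lemma lin_appD x y : dom S x -> dom S y -> S (x + y) = S x + S y.
Proof.
by move=> Sx Sy; case: linS => S0 _ /(_ 1 x y Sx Sy); rewrite !scale1r.
Qed.

Lemma lin_domB x y : dom S x -> dom S y -> dom S (x - y).
Proof.
by move=> Sx Sy; rewrite -scaleN1r; apply: lin_domD => //; exact: lin_domZ.
Qed.

Lemma lin_appB x y : dom S x -> dom S y -> S (x - y) = S x - S y.
Proof.
move=> Sx Sy; rewrite -scaleN1r lin_appD ?lin_appZ ?scaleN1r //.
by rewrite -scaleN1r; exact: lin_domZ.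
Qed.

(** The imaginary part of an inner product is a real part at i x, and
    domains are stable under multiplication by i. *)
Lemma adjoint_valueP y v : adjoint_value S y v <->
  forall x, dom S x -> ip (S x) y = ip x v.
Proof.
split=> [Syv x Sx|Syv x Sx]; first by rewrite /ip Syv.
have ImE (u1 u2 : H) : complex.Im (inner u1 u2) = - ip ('i%C *: u1) u2.
  have Rei (t : R[i]) : complex.Im t = - complex.Re ('i%C * t).
    by case: t => p q /=; ring.
  by rewrite /ip linearZl_LR; exact: Rei.
apply/eqP; rewrite eq_complex; apply/andP; split; apply/eqP; first exact: Syv.
by rewrite !ImE -Syv ?lin_appZ //; exact: lin_domZ.
Qed.

End linear_operators.

(** * The regularizing operators (1 + e T* T)^-1 *)

Section regularization.
Local Open Scope complex_scope.
Context {R : realType} {H : hilbertType R}.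
Variable T : operator H.
Implicit Types (x y f : H) (e d : R).

(** The weak form of x + e T* T x = f: it does not presuppose that T x lies in
    the domain of the adjoint. *)
Definition regularizes e f x :=
  dom T x /\ forall y, dom T y -> e * ip (T y) (T x) = ip y (f - x).

Hypotheses (linT : linear_operator T).

Lemma weighted_sqr_ge0 e (p q : R) : 0 <= e -> 0 <= e * p ^+ 2 + q ^+ 2.
Proof.
by move=> e0; apply: addr_ge0; rewrite ?sqr_ge0 // mulr_ge0 ?sqr_ge0.
Qed.

Section existence.
Variables (e : R) (f : H).
Hypothesis e_gt0 : 0 < e.

Let energy x := e * hnorm (T x) ^+ 2 + hnorm x ^+ 2.
Let slope x u := e * ip (T u) (T x) + ip u (x - f).

(** Up to a factor 2, [slope x u] is the derivative of
    J x = e |T x|^2 + |x - f|^2 in the direction u, and [energy u] is the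
    quadratic part of J. If J x is within d^2 of its infimum, the quadratic
    polynomial t |-> d^2 + 2 t slope + t^2 energy is nonnegative, so its
    discriminant is not positive. *)
Lemma slope_small d : 0 < d -> exists x, dom T x /\
  forall u, dom T u -> `|slope x u| <= d * Num.sqrt (energy u).
Proof.
move=> d_gt0; pose J x := e * hnorm (T x) ^+ 2 + hnorm (x - f) ^+ 2.
have J_ge0 x : 0 <= J x by exact/weighted_sqr_ge0/ltW.
have hJ : has_inf (J @` dom T).
  split; first by exists (J 0), 0 => //; exact: lin_dom0.
  by exists 0 => _ [x _ <-].
have d2_gt0 : 0 < d ^+ 2 by rewrite exprn_gt0.
have [_ [x Tx <-] Jx] := inf_adherent d2_gt0 hJ.
exists x; split=> // u Tu.
have Jt t : 0 <= d ^+ 2 + 2 * t * slope x u + t ^+ 2 * energy u.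
  have Ttu : dom T (t%:C *: u) by exact: lin_domZ.
  have Txt : dom T (x + t%:C *: u) by exact: lin_domD.
  have : inf (J @` dom T) <= J (x + t%:C *: u).
    by apply: ge_inf; [exact: hJ.2|exists (x + t%:C *: u)].
  have -> : J (x + t%:C *: u) = J x + 2 * t * slope x u + t ^+ 2 * energy u.
    rewrite /J /slope /energy lin_appD // lin_appZ // (addrAC x).
    rewrite hnorm_sqrD (hnorm_sqrD (x - f)) !ipZr !hnormZr !exprMn.
    by rewrite !real_normK ?num_real // (ipC u) (ipC (T u)); ring.
  lra.
have energy_ge0 : 0 <= energy u.
  by exact/weighted_sqr_ge0/ltW.
have := energy_ge0; rewrite le_eqVlt => /orP[/eqP u0|u_gt0].
  have u2 : hnorm u ^+ 2 = 0.
    have h1 : 0 <= e * hnorm (T u) ^+ 2 by rewrite mulr_ge0 ?sqr_ge0 // ltW.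
    have h2 := sqr_ge0 (hnorm u).
    by move: u0; rewrite /energy; lra.
  have -> : u = 0 by apply/hnorm_eq0/eqP; rewrite -sqrf_eq0 u2.
  rewrite /slope lin_app0 // !ip0l mulr0 addr0 normr0.
  by rewrite mulr_ge0 ?sqrtr_ge0 // ltW.
(* The minimum of the polynomial in t. *)
have := Jt (- (slope x u / energy u)).
have -> : d ^+ 2 + 2 * - (slope x u / energy u) * slope x u +
    (- (slope x u / energy u)) ^+ 2 * energy u =
    d ^+ 2 - slope x u ^+ 2 / energy u.
  by field; rewrite gt_eqF.
rewrite subr_ge0 ler_pdivrMr // => h.
rewrite -(ler_pXn2r (n := 2)) ?nnegrE ?mulr_ge0 ?sqrtr_ge0 //; last exact: ltW.
by rewrite real_normK ?num_real // exprMn sqr_sqrtr.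
Qed.

Hypothesis clT : closed_operator T.

(** Almost-minimizers of J form a Cauchy sequence for the graph norm of T,
    because [energy (x - y)] is the difference of the slopes of J at x and at y
    in the direction x - y. The closedness of T puts the limit in the domain,
    and there the slope vanishes. *)
Lemma regularizes_exists : exists x, regularizes e f x.
Proof.
have dpos n : 0 < n.+1%:R^-1 :> R by rewrite invr_gt0 ltr0n.
have [x xP] := choice (fun n => slope_small (dpos n)).
have Tx n : dom T (x n) by case: (xP n).
have energyB m n : Num.sqrt (energy (x m - x n)) <= m.+1%:R^-1 + n.+1%:R^-1.
  set u := x m - x n; have Tu : dom T u by exact: lin_domB.
  have uE : energy u = slope (x m) u - slope (x n) u.
    rewrite /energy /slope !hnorm_sqr /u lin_appB //.
    by rewrite !(ipDl, ipDr, ipNl, ipNr); ring.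
  have E0 : 0 <= energy u by exact/weighted_sqr_ge0/ltW.
  have hm := le_trans (ler_norm _) ((xP m).2 u Tu).
  have := (xP n).2 u Tu; rewrite ler_norml => /andP[hn _].
  have := sqr_sqrtr E0; set q := Num.sqrt (energy u) in hm hn * => q2.
  have := sqrtr_ge0 (energy u); rewrite -/q le_eqVlt => /orP[/eqP <-|q0].
    by rewrite addr_ge0 // ltW.
  rewrite -(ler_pM2r q0) -expr2 q2 uE mulrDl.
  move: (m.+1%:R^-1 * q) (n.+1%:R^-1 * q) hm hn => ? ? hm hn; lra.
have e2_gt0 : 0 < Num.sqrt e by rewrite sqrtr_gt0.
have small d : 0 < d -> exists N, forall n, (N <= n)%N -> n.+1%:R^-1 < d :> R.
  move=> d0; exists (Num.truncn d^-1) => n Nn.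
  rewrite -[d]invrK ltf_pV2 ?posrE ?invr_gt0 ?ltr0n //.
  apply: lt_le_trans (truncnS_gt _) _; rewrite ler_nat; exact: Nn.
have small2 d : 0 < d -> exists N, forall m n, (N <= m)%N -> (N <= n)%N ->
    m.+1%:R^-1 + n.+1%:R^-1 < d :> R.
  move=> d0; have [|N NP] := small (d / 2); first by rewrite divr_gt0.
  by exists N => m n /NP ? /NP ?; rewrite [d]splitr ltrD.
have [|y xy] := @hcomplete _ _ x.
  move=> d /small2[N NP]; exists N => m n Nm Nn.
  apply: le_lt_trans (le_trans _ (energyB m n)) (NP _ _ Nm Nn).
  rewrite -[leLHS]ger0_norm ?hnorm_ge0 // -sqrtr_sqr ler_wsqrtr //.
  by rewrite /energy lerDr mulr_ge0 ?sqr_ge0 // ltW.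
have [|z xz] := @hcomplete _ _ (T \o x).
  move=> d d0; have [|N NP] := small2 (Num.sqrt e * d); first exact: mulr_gt0.
  exists N => m n Nm Nn; rewrite -(ltr_pM2l e2_gt0).
  apply: le_lt_trans (le_trans _ (energyB m n)) (NP _ _ Nm Nn).
  rewrite -[leLHS]ger0_norm ?mulr_ge0 ?sqrtr_ge0 ?hnorm_ge0 //.
  rewrite -sqrtr_sqr ler_wsqrtr // exprMn (sqr_sqrtr (ltW e_gt0)).
  by rewrite /energy /= lin_appB // lerDl sqr_ge0.
have [Ty yz] := closed_operatorP clT Tx xy xz.
exists y; split=> // u Tu; apply/eqP.
have -> : (e * ip (T u) (T y) == ip u (f - y)) = (slope y u == 0).
  by rewrite /slope -[f - y]opprB ipNr -subr_eq0 opprK.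
rewrite -normr_eq0 eq_le normr_ge0 andbT.
apply/ler_addgt0Pl => d d0; rewrite addr0.
pose M := e * hnorm (T u) + hnorm u + Num.sqrt (energy u) + 1.
have M0 : 0 < M.
  by rewrite ltr_wpDl // !addr_ge0 ?mulr_ge0 ?hnorm_ge0 ?sqrtr_ge0 // ltW.
have dM : 0 < d / M by rewrite divr_gt0.
have [N1 h1] := small _ dM.
have [N2 h2] := xy _ dM.
have [N3 h3] := xz _ dM.
pose n := maxn N1 (maxn N2 N3).
have {}h1 := h1 n (leq_maxl _ _).
have {}h2 : hnorm (x n - y) < d / M.
  by apply: h2; rewrite /n maxnCA leq_maxl.
have {}h3 : hnorm (T (x n) - T y) < d / M.
  by rewrite yz; apply: h3; rewrite /n !leq_max leqnn !orbT.
have -> : slope y u = slope (x n) u - e * ip (T u) (T (x n) - T y) - ip u (x n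
  - y).
  by rewrite /slope !(ipDr, ipNr); ring.
have absip (a b : H) : `|ip a b| <= hnorm a * hnorm b.
  by rewrite ler_norml ip_le andbT lerNl -ipNl -(hnorm_opp a) ip_le.
have k1 := (xP n).2 u Tu.
have k2 := absip (T u) (T (x n) - T y).
have k3 := absip u (x n - y).
have -> : d = (e * hnorm (T u) + hnorm u + Num.sqrt (energy u) + 1) * (d / M).
  by rewrite -/M mulrC divfK // gt_eqF.
apply: le_trans (ler_normB _ _) _.
apply: le_trans (lerD (ler_normB _ _) (lexx _)) _.
rewrite normrM (gtr0_norm e_gt0).
have l1 : n.+1%:R^-1 * Num.sqrt (energy u) <= d / M * Num.sqrt (energy u).
  by rewrite ler_wpM2r ?sqrtr_ge0 // ltW.
have l2 : hnorm (T u) * hnorm (T (x n) - T y) <= hnorm (T u) * (d / M).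
  by rewrite ler_wpM2l ?hnorm_ge0 // ltW.
have l3 : hnorm u * hnorm (x n - y) <= hnorm u * (d / M).
  by rewrite ler_wpM2l ?hnorm_ge0 // ltW.
have := ler_wpM2l (ltW e_gt0) (le_trans k2 l2).
have := le_trans k1 l1; have := le_trans k3 l3.
move: (d / M) dM {k1 k2 k3 l1 l2 l3 h1 h2 h3} => D D0 k1 k2 k3.
rewrite !mulrDl mul1r -mulrA; lra.
Qed.

End existence.

Lemma regularizes_comb e f g x y c : regularizes e f x -> regularizes e g y ->
  regularizes e (f - c *: g) (x - c *: y).
Proof.
move=> [Tx xP] [Ty yP]; have Tcy := lin_domZ linT c Ty.
split=> [|u Tu]; first exact: lin_domB.
rewrite lin_appB // lin_appZ // ipDr ipNr mulrBr xP //.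
have Tcu := lin_domZ linT (c^*)%R Tu.
have := yP _ Tcu; rewrite lin_appZ // !ipZlJ !conjCK => ->.
by rewrite scalerBr !(ipDr, ipNr); ring.
Qed.

(** Test the weak equation against y = x and drop the term e |T x|^2. *)
Lemma regularizes_contraction e f x : 0 <= e -> regularizes e f x ->
  hnorm x <= hnorm f.
Proof.
move=> e0 [Tx /(_ x Tx)]; rewrite ipDr ipNr -!hnorm_sqr => xP.
have h1 : 0 <= e * hnorm (T x) ^+ 2 by rewrite mulr_ge0 ?sqr_ge0.
have := ip_le x f; have := hnorm_ge0 x; rewrite le_eqVlt => /orP[/eqP <- _|x0].
  exact: hnorm_ge0.
by move=> h2; rewrite -(ler_pM2l x0) -expr2; lra.
Qed.

(** Test the weak equation against y = f - x. The operators thus tend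
    strongly to the identity on the domain of T as e tends to 0. *)
Lemma regularizes_near e f x : 0 <= e -> regularizes e f x -> dom T f ->
  hnorm (f - x) ^+ 2 <= e * hnorm (T f) ^+ 2.
Proof.
move=> e0 [Tx xP] Tf; rewrite hnorm_sqr -xP; last exact: lin_domB.
rewrite lin_appB // ipDl ipNl -hnorm_sqr ler_wpM2l //.
have := ip_le (T f) (T x).
move: (ip _ _) (hnorm (T f)) (hnorm (T x)) (hnorm_ge0 (T f)) (hnorm_ge0 (T x)).
by move=> p q r q0 r0 h; nra.
Qed.

Lemma regularizes_adjoint e f x : 0 < e -> regularizes e f x ->
  adjoint_value T (T x) (e^-1%:C *: (f - x)).
Proof.
move=> e0 [Tx xP]; apply/adjoint_valueP => // y Ty.
by rewrite ipZr -xP // mulKf // gt_eqF.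
Qed.

End regularization.

(** * Log-convexity of the orbits of a shifted normal operator *)

Section normal_operators.
Local Open Scope complex_scope.
Context {R : realType} {H : hilbertType R}.
Variable T : operator H.
Hypothesis normT : normal_operator T.
Implicit Types (x y u v f : H) (e : R).

Let linT : linear_operator T. Proof. by case: normT. Qed.
Let clT : closed_operator T. Proof. by case: normT. Qed.

(** The difference of two values is orthogonal to a dense subspace. *)
Lemma adjoint_value_uniq y u v :
  adjoint_value T y u -> adjoint_value T y v -> u = v.
Proof.
case: normT => _ _ dT _ yu yv.
apply/eqP; rewrite -subr_eq0; apply/eqP/hnorm_eq0.
have w_perp x : dom T x -> ip x (u - v) = 0.
  move=> Tx; rewrite ipDr ipNr.
  have /adjoint_valueP <- // := yu; have /adjoint_valueP <- // := yv.
  exact: subrr.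
move: (u - v) w_perp => w w_perp.
apply/eqP; rewrite eq_le hnorm_ge0 andbT; apply/ler_addgt0Pl => d d0.
rewrite addr0 leNgt; apply/negP => dw; have w0 := lt_trans d0 dw.
have [x Tx xw] := densely_definedP w dT d0.
have : hnorm w ^+ 2 < hnorm w * hnorm w.
  rewrite hnorm_sqr -[X in ip X w](subrK x) ipDl (w_perp x) // addr0.
  by apply: le_lt_trans (ip_le _ _) _; rewrite ltr_pM2r // (lt_trans xw).
by rewrite -expr2 ltxx.
Qed.

(** The equality T T* = T* T without the choice operator that defines the
    values of the adjoint. *)
Lemma normal_adjointP y v : (dom T y /\ adjoint_value T (T y) v) <->
  exists u, [/\ adjoint_value T y u, dom T u & T u = v].
Proof.
case: normT => _ _ _ [domE appE].
have adjE u : adjoint_value T y u -> get (adjoint_value T y) = u.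
  by move=> yu; apply: adjoint_value_uniq (yu);
    exact: (getPex (ex_intro _ u yu)).
have adjTE : adjoint_value T (T y) v -> get (adjoint_value T (T y)) = v.
  by move=> yv; apply: adjoint_value_uniq (yv);
    exact: (getPex (ex_intro _ v yv)).
split=> [[Ty yv]|[u [yu Tu uv]]].
  have yD : dom (op_comp (adjoint T) T) y by split=> //; exists v.
  rewrite -domE in yD; have [[u yu] Tu] := yD.
  have := appE _ yD; rewrite /= (adjE _ yu) (adjTE yv) => uv;
    rewrite /= (adjE _ yu) in Tu.
  by exists u.
have yD : dom (op_comp T (adjoint T)) y by split;
  [exists u|rewrite /= (adjE _ yu)].
have := appE _ yD; rewrite domE in yD; have [Ty [w yw]] := yD.
rewrite /= (adjE _ yu) uv => vE; split=> //.
by rewrite vE; exact: (getPex (ex_intro _ w yw)).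
Qed.

(** (1 + e T* T)^-1 commutes with T. Apply T to x + e T* T x = f: since
    T* T x = (f - x) / e lies in the domain of T, the vector T x is in the
    domain of T T*, hence of T* T, and T T* T x = T* T T x. *)
Lemma regularizes_app e f x : 0 < e -> regularizes T e f x -> dom T f ->
  regularizes T e (T f) (T x).
Proof.
move=> e0 xP Tf; have [Tx _] := xP; have Tfx := lin_domB linT Tf Tx.
have Tefx := lin_domZ linT (e^-1)%:C Tfx.
have [TTx /adjoint_valueP TTxP] : dom T (T x) /\
    adjoint_value T (T (T x)) (T (e^-1%:C *: (f - x))).
  apply/normal_adjointP; exists (e^-1%:C *: (f - x)); split=> //.
  exact: regularizes_adjoint.
split=> // y Ty; rewrite TTxP // lin_appZ // lin_appB // ipZr mulVKf //.
by rewrite gt_eqF.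
Qed.

(** The vector u is S* y = T* y - w^* y for S = T - w. The norms of T y and
    T* y agree because |T y|^2 = <y, T* T y> = <y, T T* y>, and the cross terms
    with w y agree by the definition of T*. *)
Lemma normal_shift y v (w : R[i]) : dom T y -> adjoint_value T (T y) v ->
  exists2 u, hnorm u = hnorm (op_shift T w y) &
    forall x, dom T x -> ip (op_shift T w x) y = ip x u.
Proof.
move=> Ty yv; have [u [yu Tu uv]] : exists u, [/\ adjoint_value T y u, dom T u
  & T u = v].
  exact/normal_adjointP.
have /adjoint_valueP-/(_ linT) yuP := yu;
  have /adjoint_valueP-/(_ linT) yvP := yv.
exists (u - w^* *: y); last first.
  by move=> x Tx; rewrite ipDl ipDr !ipNr ipNl yuP // ipZlJ.
apply/eqP; rewrite -(eqrXn2 (n := 2)) ?hnorm_ge0 // !hnorm_sqrB.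
apply/eqP; congr (_ - _ * _ + _).
- by rewrite !hnorm_sqr yvP // -uv -yuP // ipC.
- rewrite ipC -yuP; last exact: lin_domZ.
  by rewrite lin_appZ // ipZlJ conjCK.
- by rewrite !hnormZ_sqr; case: (w) => p q /=; rewrite sqrrN.
Qed.

(** Let x = (1 + e T* T)^-1 v. Both x and S x lie in D(T* T), so
    |S x|^2 = <x, S* S x> <= |x| |S (S x)|. By contractivity and commutation
    with T, the right-hand side is at most |v| |S (S v)|, while |S x - S v| is
    of the order of the square root of e. *)
Lemma normal_shift_sqr v (w : R[i]) : dom T v -> dom T (op_shift T w v) ->
  hnorm (op_shift T w v) ^+ 2 <=
  hnorm v * hnorm (op_shift T w (op_shift T w v)).
Proof.
set S := op_shift T w => Tv TSv.
have STZ y : dom T y -> dom T (S y) -> T (S y) = S (T y).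
  move=> Ty TSy.
  rewrite /S /op_shift lin_appB ?lin_appZ //; last exact: lin_domZ.
  rewrite -[T y](subrK (w *: y)); apply: lin_domD => //; exact: lin_domZ.
have TTv : dom T (T v).
  by rewrite -[T v](subrK (w *: v)); apply: lin_domD => //; exact: lin_domZ.
have bound e : 0 < e -> hnorm (S v) <=
    Num.sqrt (hnorm v * hnorm (S (S v))) + Num.sqrt (e * hnorm (T (S v)) ^+ 2).
  move=> e0; have [x xP] := regularizes_exists linT v e0 clT.
  have TxP := regularizes_app e0 xP Tv.
  have SxP : regularizes T e (S v) (S x) by exact: regularizes_comb.
  have TSxP := regularizes_app e0 SxP TSv.
  have SSxP : regularizes T e (S (S v)) (S (S x)) by exact: regularizes_comb.
  have [Tx _] := xP; have [TSx _] := SxP.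
  have Sx2 : hnorm (S x) ^+ 2 <= hnorm v * hnorm (S (S v)).
    have [u uE uP] := normal_shift w TSx
      (regularizes_adjoint linT e0 SxP).
    rewrite hnorm_sqr uP //; apply: le_trans (ip_le _ _) _.
    rewrite uE ler_pM ?hnorm_ge0 //.
      exact: regularizes_contraction (ltW e0) xP.
    exact: regularizes_contraction (ltW e0) SSxP.
  rewrite -{1}[S v](subrK (S x)) addrC; apply: le_trans (ler_hnormD _ _) _.
  apply: lerD.
    by rewrite -[leLHS]ger0_norm ?hnorm_ge0 // -sqrtr_sqr ler_wsqrtr.
  rewrite -[leLHS]ger0_norm ?hnorm_ge0 // -sqrtr_sqr ler_wsqrtr //.
  exact: regularizes_near (ltW e0) SxP TSv.
have bound0 : 0 <= hnorm v * hnorm (S (S v)) by rewrite mulr_ge0 ?hnorm_ge0.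
rewrite -(sqr_sqrtr bound0) ler_pXn2r ?nnegrE ?hnorm_ge0 ?sqrtr_ge0 //.
apply/ler_addgt0Pr => d d0.
set K := hnorm (T (S v)); have K0 : 0 <= K by exact: hnorm_ge0.
have K1 : 0 < K + 1 by rewrite ltr_wpDl.
apply: le_trans (bound ((d / (K + 1)) ^+ 2) _) _.
  by rewrite exprn_gt0 // divr_gt0.
rewrite lerD2l -exprMn sqrtr_sqr ger0_norm;
  last by rewrite mulr_ge0 // divr_ge0 // ltW.
by rewrite -mulrA ler_piMr ?(ltW d0) // mulrC ler_pdivrMr // mul1r lerDl.
Qed.

End normal_operators.

(** * Parseval identity over the roots of unity *)

Section parseval.
Local Open Scope complex_scope.
Context {R : realType} {H : hilbertType R}.

(** A 2^n-th root z of -1 satisfies z^(2^(n+1)) = 1 but not z^(2^n) = 1, and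
    the divisors of 2^(n+1) other than itself divide 2^n. *)
Lemma prim_root_pow2 n : exists z : R[i], (2 ^ n.+1).-primitive_root z.
Proof.
pose z : R[i] := (2 ^ n).-root (-1).
have zn : z ^+ (2 ^ n) = -1 by rewrite rootCK // expn_gt0.
have z1 : z ^+ (2 ^ n.+1) = 1 by rewrite expnSr exprM zn sqrrN expr1n.
have [m zm /dvdn_pfactor-/(_ isT)[k kn mk]] :=
  prim_order_exists (expn_gt0 2 n.+1) z1.
exists z; move: kn; rewrite leq_eqVlt => /orP[/eqP <-|]; first by rewrite -mk.
rewrite ltnS => kn; exfalso; have : z ^+ (2 ^ n) == 1.
  by rewrite -(prim_order_dvd zm) mk dvdn_exp2l.
by rewrite zn eqNr oner_eq0.
Qed.

Lemma ip_suml (I : Type) (r : seq I) (F : I -> H) y :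
  ip (\sum_(i <- r) F i) y = \sum_(i <- r) ip (F i) y.
Proof. exact: (big_morph (fun x => ip x y) (fun a b => ipDl a b y) (ip0l y)).
  Qed.

Lemma ip_sumr (I : Type) (r : seq I) (F : I -> H) y :
  ip y (\sum_(i <- r) F i) = \sum_(i <- r) ip y (F i).
Proof. by rewrite ipC ip_suml; apply: eq_bigr => i _; rewrite ipC. Qed.

Lemma unity_root_norm n (z : R[i]) : (0 < n)%N -> z ^+ n = 1 -> `|z| = 1.
Proof.
move=> n0 zn; apply/eqP; rewrite -(pexpr_eq1 n0) //.
by rewrite -normrX zn normr1.
Qed.

(** The k-th and l-th terms contribute <u k, u l> times the sum over m of
    (z^k conj(z^l))^m, a geometric sum that vanishes unless k = l. *)
Lemma parseval n (z : R[i]) (u : 'I_n -> H) : n.-primitive_root z ->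
  \sum_(m < n) hnorm (\sum_(k < n) (z ^+ m) ^+ k *: u k) ^+ 2 =
  n%:R * \sum_(k < n) hnorm (u k) ^+ 2.
Proof.
move=> zP; have n0 := prim_order_gt0 zP.
have zJ : z * (z^*)%R = 1.
  by rewrite -normCK (unity_root_norm n0) ?expr1n // prim_expr_order.
have gsum (k l : 'I_n) : \sum_(m < n) (((z^*)%R ^+ l * z ^+ k) ^+ m) =
    if k == l then n%:R else 0.
  case: eqP => [->|/eqP kl].
    rewrite -exprMn [(z^*)%R * z]mulrC zJ expr1n.
    by under eq_bigr do rewrite expr1n; rewrite sumr_const card_ord.
  set t := (z^*)%R ^+ l * z ^+ k.
  have t1 : t != 1.
    apply: contra kl => /eqP t1; apply/eqP/val_inj => /=.
    have : z ^+ k == z ^+ l.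
      by rewrite -[z ^+ k]mul1r -(expr1n _ l) -zJ exprMn -mulrA -/t t1 mulr1.
    by rewrite (eq_prim_root_expr zP) !modn_small // => /eqP.
  have tn : t ^+ n = 1.
    rewrite exprMn -!exprM ![(_ * n)%N]mulnC !exprM -rmorphXn /=.
    by rewrite (prim_expr_order zP) rmorph1 !expr1n mulr1.
  apply/eqP; have := subrX1 t n; rewrite tn subrr => /esym/eqP.
  by rewrite mulf_eq0 subr_eq0 (negPf t1).
transitivity (\sum_(k < n) \sum_(l < n)
    ip ((\sum_(m < n) ((z^*)%R ^+ l * z ^+ k) ^+ m) *: u k) (u l)).
  under eq_bigr => m _.
    rewrite hnorm_sqr ip_suml.
    under eq_bigr => k _ do rewrite ip_sumr.
    over.
  rewrite exchange_big /=; apply: eq_bigr => k _.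
  rewrite exchange_big /=; apply: eq_bigr => l _.
  rewrite scaler_suml ip_suml; apply: eq_bigr => m _.
  rewrite [LHS]ipC ipZlJ ipC scalerA; congr (ip (_ *: _) _).
  by rewrite exprMn -!exprM -rmorphXn /= mulnC [(m * k)%N]mulnC.
rewrite mulr_sumr; apply: eq_bigr => k _.
rewrite (bigD1 k) //= gsum eqxx big1 ?addr0 => [|l lk]; last first.
  by rewrite gsum eq_sym (negPf lk) scale0r ip0l.
rewrite hnorm_sqr.
have -> : n%:R = (n%:R : R)%:C :> R[i] by rewrite rmorph_nat.
exact: ipZl.
Qed.

End parseval.

(** * Lower bounds of T - z and the resolvent set *)

Section resolvent_bounds.
Local Open Scope complex_scope.
Context {R : realType} {H : hilbertType R}.
Variable T : operator H.

Definition bounded_below (z : R[i]) (d : R) :=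
  forall x, dom T x -> d * hnorm x <= hnorm (op_shift T z x).

Lemma resolvent_dom z y : resolvent_set T z -> dom T (resolvent T z y).
Proof.
by move=> [[_ _ sS] _]; apply: (surjpinv_image_sub sS); exists y.
Qed.

Lemma op_shiftK z y : resolvent_set T z -> op_shift T z (resolvent T z y) = y.
Proof.
move=> [[_ _ sS] _]; apply: pinvK; rewrite inE.
exact: sS.
Qed.

Lemma resolventK z x : resolvent_set T z -> dom T x ->
  resolvent T z (op_shift T z x) = x.
Proof. by move=> [[_ iS _] _] Tx; apply: pinvKV => //; rewrite inE. Qed.

Lemma resolvent_bounded_below z : resolvent_set T z ->
  exists2 d, 0 < d & bounded_below z d.
Proof.
move=> zT; have [_ [M MP]] := zT.
have M1 : 0 < `|M| + 1 by rewrite ltr_wpDl.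
exists (`|M| + 1)^-1; first by rewrite invr_gt0.
move=> x Tx; rewrite mulrC ler_pdivrMr // mulrC.
have := MP (op_shift T z x); rewrite resolventK // => /le_trans; apply.
rewrite ler_wpM2r ?hnorm_ge0 //.
by apply: le_trans (ler_norm M) _; rewrite lerDl.
Qed.

Lemma hnormZ_le (c : R[i]) (x : H) :
  hnorm (c *: x) <= (`|complex.Re c| + `|complex.Im c|) * hnorm x.
Proof.
rewrite hnormZ ler_wpM2r ?hnorm_ge0 //.
rewrite -[leRHS]ger0_norm ?addr_ge0 // -sqrtr_sqr ler_wsqrtr //.
rewrite sqrrD !real_normK ?num_real // addrAC lerDl.
by rewrite mulrn_wge0 // mulr_ge0.
Qed.

(** The best lower bound of T - z is a 1-Lipschitz function of z, here for
    the l^1 norm of the plane. *)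
Lemma bounded_below_perturb z z' d e : bounded_below z d ->
  `|complex.Re (z' - z)| + `|complex.Im (z' - z)| <= e ->
  bounded_below z' (d - e).
Proof.
move=> zd ze x Tx; have h1 := hnormZ_le (z' - z) x.
have h2 := ler_wpM2r (hnorm_ge0 x) ze.
have h3 : hnorm (op_shift T z x) <=
    hnorm (op_shift T z' x) + hnorm ((z' - z) *: x).
  apply: le_trans (ler_hnormD _ _).
  by rewrite /op_shift scalerBl addrA subrK.
by have := zd _ Tx; lra.
Qed.

(** Each point of the circle has a neighbourhood with a common lower bound,
    and the circle is compact. *)
Lemma circle_bounded_below (w : R[i]) (m : R) :
  (forall z, complex.Re (z - w) ^+ 2 + complex.Im (z - w) ^+ 2 = m ^+ 2 ->
     resolvent_set T z) ->
  exists2 d, 0 < d & forall z,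
    complex.Re (z - w) ^+ 2 + complex.Im (z - w) ^+ 2 = m ^+ 2 ->
    bounded_below z d.
Proof.
move=> wT.
pose F (p : R * R) := p.1 ^+ 2 + p.2 ^+ 2.
pose K : set (R * R) := (`[- `|m|, `|m|] `*` `[- `|m|, `|m|]) `&` (F @^-1` [set
  m ^+ 2]).
have cK : compact K.
  apply: compact_closedI.
    by apply: compact_setX; exact: segment_compact.
  apply: (continuous_closedP F).1; last exact: closed_eq.
  move=> p; apply: (@cvgD R R _ (nbhs p)).
    by apply: (@cvgM R _ (nbhs p)); exact: cvg_fst.
  by apply: (@cvgM R _ (nbhs p)); exact: cvg_snd.
have near_cov := (compact_near_coveringP K).1 cK.
pose P (d : R) (p : R * R) := bounded_below (w + (p.1 +i* p.2)) d.
have : \forall d \near 0^'+, K `<=` P d.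
  apply: near_cov => -[p1 p2] [_ pm].
  have [|d d0 dP] := @resolvent_bounded_below (w + (p1 +i* p2)).
    by apply: wT; rewrite addrAC subrr add0r.
  have d4 : 0 < d / 4 by rewrite divr_gt0.
  exists ((ball (p1, p2) (d / 4)), [set e | e < d / 2]) => /=.
    split; first exact: nbhsx_ballx.
    by apply: nbhs_right_lt; rewrite divr_gt0.
  move=> [[q1 q2] e] /= [[]]; rewrite /ball /= => pq1 pq2 ed x Tx.
  have /(_ x Tx) : bounded_below (w + (q1 +i* q2)) (d - d / 2).
    apply: bounded_below_perturb dP _.
    rewrite opprD addrACA subrr add0r /= distrC (distrC q2).
    lra.
  apply: le_trans; rewrite ler_wpM2r ?hnorm_ge0 //; lra.
move=> [e /= e0 eP]; exists (e / 2); first by rewrite divr_gt0.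
move=> z zm; have zE : z = w + (complex.Re (z - w) +i* complex.Im (z - w)).
  by rewrite -[LHS](subrK w) addrC; case: (z - w).
have eK : K `<=` P (e / 2).
  apply: eP; rewrite ?divr_gt0 //=.
  by rewrite sub0r normrN gtr0_norm ?divr_gt0 // ltr_pdivrMr // ltr_pMr //
    ltr1n.
rewrite zE; apply: (eK (_, _)).
have sqle (p q : R) : p ^+ 2 + q ^+ 2 = m ^+ 2 -> - `|m| <= p <= `|m|.
  move=> pqm; rewrite -ler_norml -ler_sqr ?nnegrE // !real_normK ?num_real //.
  by rewrite -pqm lerDl sqr_ge0.
split; last exact: zm.
by split; rewrite /= in_itv /=; [|move: zm; rewrite addrC => zm];
  exact: sqle zm.
Qed.

End resolvent_bounds.

(** * The distance to the spectrum bounds T - w from below *)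

Section distance_to_spectrum.
Local Open Scope complex_scope.
Context {R : realType} {H : hilbertType R}.
Variable T : operator H.
Hypothesis normT : normal_operator T.

Let linT : linear_operator T. Proof. by case: normT. Qed.

Lemma op_shift_sum (w : R[i]) (I : Type) (r : seq I) (c : I -> R[i]) (v : I ->
  H) :
  (forall i, dom T (v i)) -> dom T (\sum_(i <- r) c i *: v i) /\
  op_shift T w (\sum_(i <- r) c i *: v i) = \sum_(i <- r) c i *: op_shift T w
    (v i).
Proof.
move=> Tv; elim: r => [|i r [IHd IHe]].
  rewrite !big_nil; split; first exact: lin_dom0.
  by rewrite /op_shift lin_app0 // scaler0 subrr.
rewrite !big_cons; have Tcv := lin_domZ linT (c i) (Tv i).
split; first exact: lin_domD.
rewrite -IHe /op_shift lin_appD // lin_appZ //.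
by rewrite scalerDr opprD addrACA scalerBr !scalerA [w * _]mulrC.
Qed.

Lemma bernoulli_sub n (t : R) : 0 <= t <= 1 -> 1 - n%:R * t <= (1 - t) ^+ n.
Proof.
move=> /andP[t0 t1]; elim: n => [|n IH]; first by rewrite mul0r subr0 expr0.
have s0 : 0 <= 1 - t by rewrite subr_ge0.
rewrite exprS; apply: le_trans (ler_wpM2l s0 IH).
rewrite -natr1; have : 0 <= n%:R * t ^+ 2 by rewrite mulr_ge0 ?sqr_ge0.
by move: (n%:R : R) => N h; nra.
Qed.

(** If U = m (T - w)^-1 is a contraction and the points of the circle of
    radius m around w are uniformly resolvent, then the norm of U is less
    than 1. Otherwise some y has |U y| > (1 - t) |y| with t tiny, and the
    orbit of y loses little norm during K steps. A discrete Fourier coefficient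
    h of this orbit is then large compared with (1 - v U) h = y - U^K y, that
    is, g = (T - w)^-1 h is an approximate eigenvector at w + v m, on the
    circle. *)
Lemma resolvent_norm_improve (w : R[i]) (m d : R) :
  resolvent_set T w -> 0 < m -> 0 < d ->
  (forall y, m * hnorm (resolvent T w y) <= hnorm y) ->
  (forall z, complex.Re (z - w) ^+ 2 + complex.Im (z - w) ^+ 2 = m ^+ 2 ->
     bounded_below T z d) ->
  exists2 q, 0 < q < 1 & forall y, m * hnorm (resolvent T w y) <= q * hnorm y.
Proof.
move=> wT m0 d0; set B := resolvent T w => mB circle.
set S := op_shift T w.
have TB y : dom T (B y) by exact: resolvent_dom.
have SB y : S (B y) = y by exact: op_shiftK.
(* The lower bound d on the circle will give |h| <= C |y|, and the Fourier
   coefficient satisfies |h|^2 >= K |y|^2 / 2. *)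
pose C := 2 + 2 * m / d.
have C0 : 0 < C by rewrite addr_gt0 // divr_gt0 // mulr_gt0.
have [i iC] : exists i, 2 * C ^+ 2 < (2 ^ i.+1)%:R.
  exists (Num.truncn (2 * C ^+ 2)).
  apply: lt_trans (truncnS_gt _) _; rewrite ltr_nat.
  exact: ltn_expl.
pose K := (2 ^ i.+1)%N; rewrite -/K in iC.
have Kpos : (0 < K)%N by rewrite expn_gt0.
have K0 : 0 < K%:R :> R by rewrite ltr0n expn_gt0.
have [z zP] := @prim_root_pow2 R i; rewrite -/K in zP.
(* By Bernoulli's inequality (1 - t)^(2 k) >= 1 - 2 k t >= 1 / 2 for k < K. *)
pose t : R := (4 * K%:R)^-1.
have t0 : 0 < t by rewrite invr_gt0 mulr_gt0.
have K1 : 1 <= K%:R :> R by rewrite ler1n expn_gt0.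
have t14 : t <= 1 / 4.
  by rewrite /t invfM mul1r ler_piMr ?invr_ge0 // invf_le1.
exists (1 - t); first by lra.
move=> y; rewrite leNgt; apply/negP => yB.
have y0 : 0 < hnorm y.
  rewrite lt_def hnorm_ge0 andbT; apply/eqP => y0.
  by have := mB y; rewrite y0 => h; move: yB; rewrite y0; lra.
pose u k := iter k (fun x => m%:C *: B x) y.
have BZ (c : R[i]) x : B (c *: x) = c *: B x.
  rewrite -{1}[x]SB; have TcB := lin_domZ linT c (TB x).
  rewrite /S /op_shift scalerBr -lin_appZ // scalerA mulrC -scalerA.
  exact: resolventK.
have hB x : hnorm (m%:C *: B x) = m * hnorm (B x).
  by rewrite hnormZr gtr0_norm.
have u_le k : hnorm (u k.+1) <= hnorm (u k) by rewrite /u iterS hB.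
have u_conv k : hnorm (u k.+1) ^+ 2 <= hnorm (u k.+2) * hnorm (u k).
  rewrite /u !iterS -/(u k) hB BZ scalerA -rmorphM hnormZr.
  have TSBB : dom T (S (B (B (u k)))) by rewrite SB.
  have := normal_shift_sqr normT (TB (B (u k))) TSBB.
  rewrite -/S !SB => h;
    rewrite exprMn ger0_norm ?mulr_ge0 ?(ltW m0) // -expr2 -[leRHS]mulrA.
  by rewrite ler_wpM2l ?sqr_ge0.
(* By log-convexity the ratio of consecutive norms does not decrease, so it
   never falls below its initial value. *)
have u_growth k : 0 < hnorm (u k) /\ (1 - t) * hnorm (u k) <= hnorm (u k.+1).
  elim: k => [|k [uk IH]]; first by split=> //; rewrite /u /= hB ltW.
  have uk1 : 0 < hnorm (u k.+1) by apply: lt_le_trans IH; rewrite mulr_gt0 //;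
    lra.
  split=> //; rewrite -(ler_pM2r uk); apply: le_trans (u_conv k).
  by rewrite expr2 mulrAC ler_wpM2r // ltW.
have u_pow k : (1 - t) ^+ k * hnorm y <= hnorm (u k).
  elim: k => [|k IH]; first by rewrite expr0 mul1r.
  rewrite exprS -mulrA; apply: le_trans (u_growth k).2.
  by rewrite ler_wpM2l //; lra.
have u_half (k : 'I_K) : hnorm y ^+ 2 / 2 <= hnorm (u k) ^+ 2.
  have : ((1 - t) ^+ k * hnorm y) ^+ 2 <= hnorm (u k) ^+ 2.
    by rewrite ler_sqr ?nnegrE ?hnorm_ge0 // mulr_ge0 ?hnorm_ge0 ?exprn_ge0 //;
      lra.
  apply: le_trans; rewrite exprMn mulrC ler_wpM2r ?sqr_ge0 // -exprM.
  have t01 : 0 <= t <= 1 by apply/andP; split; lra.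
  apply: le_trans (bernoulli_sub _ t01).
  have : (k * 2)%:R * t <= 1 / 2.
    rewrite natrM mulrAC -ler_pdivlMr // -[leRHS]/(1 / 2 / 2).
    have -> : 1 / 2 / 2 = K%:R * t :> R.
      by rewrite /t; field; rewrite gt_eqF.
    by rewrite ler_wpM2r ?(ltW t0) // ler_nat ltnW.
  by lra.
pose h (j : nat) := \sum_(k < K) (z ^+ j) ^+ k *: u k.
(* Some root of unity does at least as well as the average in Parseval. *)
have [j hj] : exists j, K%:R * (hnorm y ^+ 2 / 2) <= hnorm (h j) ^+ 2.
  apply: contrapT => /forallNP hsmall.
  have : \sum_(j < K) hnorm (h j) ^+ 2 < \sum_(j < K) K%:R * (hnorm y ^+ 2 / 2).
    apply: ltr_sum => [|j _]; last by rewrite ltNge; apply/negP/hsmall.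
    by apply/hasP; exists (Ordinal Kpos) => //; exact: mem_index_enum.
  rewrite (parseval (fun k : 'I_K => u k) zP) sumr_const card_ord
    -[ltRHS]mulr_natl.
  rewrite ltr_pM2l // ltNge => /negP; apply.
  rewrite mulr_natl -[X in _ *+ X]card_ord -sumr_const.
  by apply: ler_sum => k _; exact: u_half.
pose v := z ^+ j.
have vK : v ^+ K = 1 by rewrite exprAC (prim_expr_order zP) expr1n.
have v1 : complex.Re v ^+ 2 + complex.Im v ^+ 2 = 1.
  have : `|v| ^+ 2 = 1 by rewrite (unity_root_norm _ vK) ?expr1n ?expn_gt0.
  by rewrite -add_Re2_Im2 => /complexI.
pose g := \sum_(k < K) v ^+ k *: B (u k).
have [Tg Sg] : dom T g /\ S g = h j.
  have [Tg Sg] := op_shift_sum w (index_enum 'I_K) (fun k => v ^+ k) (fun k =>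
    TB (u k)).
  split; [exact: Tg|apply: etrans Sg _; apply: eq_bigr => k _].
  by congr (_ *: _); exact: SB.
(* (1 - v U) h telescopes, and v^K = 1. *)
have shiftg : op_shift T (w + v * m%:C) g = y - u K.
  have -> : op_shift T (w + v * m%:C) g = S g - (v * m%:C) *: g.
    by rewrite /S /op_shift scalerDl opprD addrA.
  rewrite Sg /g scaler_sumr /h -/v -sumrB.
  under eq_bigr => k _.
    rewrite scalerA mulrAC -exprS -scalerA -/(u k.+1).
    over.
  have := telescope_sumr (fun k => v ^+ k *: u k) (leq0n K).
  rewrite big_mkord expr0 vK !scale1r /= => tele.
  by rewrite -[RHS]opprB -tele -sumrN; apply: eq_bigr => k _; rewrite opprB.
have uK : hnorm (u K) <= hnorm y.
  by elim: (K) => // k; apply: le_trans; exact: u_le.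
have g1 : d * hnorm g <= 2 * hnorm y.
  have : bounded_below T (w + v * m%:C) d.
    apply: circle; rewrite addrAC subrr add0r.
    have -> : complex.Re (v * m%:C) = complex.Re v * m by case: (v) => p q /=;
      ring.
    have -> : complex.Im (v * m%:C) = complex.Im v * m by case: (v) => p q /=;
      ring.
    by rewrite !exprMn -mulrDl v1 mul1r.
  move=> /(_ _ Tg); rewrite shiftg.
  by have := ler_hnorm_sub y (u K); lra.
have g2 : hnorm (h j) <= 2 * hnorm y + m * hnorm g.
  have -> : h j = (y - u K) + (v * m%:C) *: g.
    by rewrite -shiftg /op_shift scalerDl opprD addrA subrK -Sg.
  apply: le_trans (ler_hnormD _ _) _; apply: lerD.
    by have := ler_hnorm_sub y (u K); lra.
  by rewrite -scalerA hnormZ v1 sqrtr1 mul1r hnormZr gtr0_norm.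
have hC : hnorm (h j) <= C * hnorm y.
  apply: le_trans g2 _; rewrite /C [leRHS]mulrDl lerD2l.
  have -> : 2 * m / d * hnorm y = m * (2 * hnorm y / d) by ring.
  by rewrite ler_pM2l // ler_pdivlMr // mulrC.
have : hnorm (h j) ^+ 2 <= (C * hnorm y) ^+ 2.
  by rewrite ler_sqr ?nnegrE ?hnorm_ge0 // mulr_ge0 ?hnorm_ge0 // ltW.
move/(le_trans hj); rewrite exprMn mulrCA mulrC ler_pM2r ?exprn_gt0 //.
by rewrite leNgt => /negP; apply; rewrite ltr_pdivlMr // mulrC.
Qed.

(** At the best lower bound m of T - w, the assumption m < r would put the
    circle of radius m in the resolvent set, and [resolvent_norm_improve] would
    give the better bound m / q. *)
Lemma normal_bounded_below (w : R[i]) (r : R) : 0 < r ->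
  (forall z, complex.Re (z - w) ^+ 2 + complex.Im (z - w) ^+ 2 < r ^+ 2 ->
     resolvent_set T z) ->
  bounded_below T w r.
Proof.
move=> r0 disc x0 Tx0; rewrite leNgt; apply/negP => x0r.
have wT : resolvent_set T w.
  by apply: disc; rewrite subrr /= expr0n addr0 exprn_gt0.
have hx0 : 0 < hnorm x0.
  rewrite -(pmulr_rgt0 _ r0); apply: le_lt_trans x0r; exact: hnorm_ge0.
pose E := [set d | bounded_below T w d].
have E_ub d : E d -> d <= hnorm (op_shift T w x0) / hnorm x0.
  by move=> /(_ _ Tx0); rewrite ler_pdivlMr.
have [d d0 Ed] := resolvent_bounded_below wT.
have supE : has_sup E.
  split; first by exists d.
  by exists (hnorm (op_shift T w x0) / hnorm x0) => e /E_ub.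
pose m := sup E.
have m0 : 0 < m.
  by apply: lt_le_trans d0 _; apply: ub_le_sup => //; exact: supE.2.
have mr : m < r.
  apply: le_lt_trans (_ : hnorm (op_shift T w x0) / hnorm x0 < r).
    by apply: ge_sup; [exists d|move=> e /E_ub].
  by rewrite ltr_pdivrMr.
have mE : bounded_below T w m.
  move=> x Tx; have := hnorm_ge0 x; rewrite le_eqVlt => /orP[/eqP <-|hx].
    by rewrite mulr0 hnorm_ge0.
  rewrite -ler_pdivlMr //; apply: ge_sup; first by exists d.
  by move=> e /(_ _ Tx); rewrite ler_pdivlMr.
have [z zm|e e0 circle] := @circle_bounded_below _ _ T w m.
  by apply: disc; rewrite zm ltr_sqr ?nnegrE ?ltW.
have [y|q /andP[q0 q1] qB] := resolvent_norm_improve wT m0 e0 _ circle.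
  rewrite -{2}(op_shiftK y wT); apply: mE; exact: resolvent_dom.
have : m / q <= m.
  apply: ub_le_sup; first exact: supE.2.
  move=> x Tx; rewrite mulrAC ler_pdivrMr // mulrC [leRHS]mulrC.
  by have := qB (op_shift T w x); rewrite resolventK // mulrC.
by rewrite ler_pdivrMr // ler_pMr // leNgt q1.
Qed.

End distance_to_spectrum.

(** * Relatively bounded perturbations *)

Section perturbation.
Local Open Scope complex_scope.
Context {R : realType} {H : hilbertType R}.

(** The iterates of F at 0 form a Cauchy sequence, by the geometric decay of
    their differences. *)
Lemma contraction_fixpoint (F : H -> H) (c : R) : 0 <= c < 1 ->
  (forall x y, hnorm (F x - F y) <= c * hnorm (x - y)) -> exists x, F x = x.
Proof.
move=> /andP[c0 c1] FP; pose u n := iter n F 0.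
have c1' : 0 < 1 - c by rewrite subr_gt0.
pose M := hnorm (u 1%N - u 0%N) / (1 - c).
have M0 : 0 <= M by rewrite divr_ge0 ?hnorm_ge0 ?ltW.
have u_bnd k : hnorm (u k - u 0%N) <= M.
  elim: k => [|k IH]; first by rewrite subrr hnorm0.
  rewrite -[u k.+1](subrK (u 1%N)) -addrA.
  apply: le_trans (ler_hnormD _ _) _.
  have -> : M = c * M + hnorm (u 1%N - u 0%N) by rewrite /M; field;
    rewrite gt_eqF.
  rewrite lerD2r; apply: le_trans (FP _ _) _.
  exact: ler_wpM2l.
have u_tail n k : hnorm (u (n + k)%N - u n) <= c ^+ n * M.
  elim: n => [|n IH]; first by rewrite expr0 mul1r; exact: u_bnd.
  rewrite addSn exprS -mulrA; apply: le_trans (FP _ _) _.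
  exact: ler_wpM2l.
have small e : 0 < e -> exists N, forall n, (N <= n)%N -> c ^+ n * M < e.
  move=> e0; have M1 : 0 < M + 1 by rewrite ltr_wpDl.
  have /cvg_expr/cvgrPdist_lt/(_ _ (divr_gt0 e0 M1))[N _ NP] : `|c| < 1.
    by rewrite ger0_norm.
  exists N => n /NP;
    rewrite sub0r normrN ger0_norm ?exprn_ge0 // ltr_pdivlMr //.
  by apply: le_lt_trans; rewrite ler_wpM2l ?exprn_ge0 // lerDl.
have [|x ux] := @hcomplete _ _ u.
  move=> e e0; have [|N NP] := small (e / 2); first by rewrite divr_gt0.
  exists N => m n Nm Nn; rewrite [e]splitr -[u m](subrK (u N)) -addrA.
  apply: le_lt_trans (ler_hnormD _ _) _; rewrite (hnorm_distC (u N)).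
  have tail k : (N <= k)%N -> hnorm (u k - u N) < e / 2.
    by move=> /subnKC <-; apply: le_lt_trans (u_tail _ _) (NP _ _).
  by rewrite ltrD // tail.
exists x; apply/eqP; rewrite -subr_eq0; apply/eqP/hnorm_eq0/eqP.
rewrite eq_le hnorm_ge0 andbT; apply/ler_addgt0Pl => e e0; rewrite addr0.
have [|N NP] := ux (e / 2); first by rewrite divr_gt0.
rewrite [e]splitr -[F x](subrK (u N.+1)) -addrA.
apply: le_trans (ler_hnormD _ _) _; apply: lerD; last exact/ltW/NP.
apply: le_trans (FP _ _) _; rewrite hnorm_distC.
by apply: le_trans (ltW (NP _ (leqnn N))); rewrite ler_piMl ?hnorm_ge0 // ltW.
Qed.

Variables T A : operator H.
Hypotheses (linT : linear_operator T) (linA : linear_operator A).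
Hypothesis TA : dom T `<=` dom A.

Lemma op_shiftB (z : R[i]) x y : dom T x -> dom T y ->
  op_shift T z (x - y) = op_shift T z x - op_shift T z y.
Proof.
by move=> Tx Ty; rewrite /op_shift lin_appB // scalerBr !opprD addrACA.
Qed.

(** Lower bounds add up to |(T + A - z) x| >= d (1 - c) |x|, which gives
    injectivity and the norm of the inverse. For surjectivity, x = (T - z)^-1 y
    is a preimage of f when y = f - A (T - z)^-1 y, a fixed point of a
    contraction. *)
Lemma resolvent_set_perturb (z : R[i]) (c d : R) : 0 <= c < 1 -> 0 < d ->
  resolvent_set T z -> bounded_below T z d ->
  (forall x, dom T x -> hnorm (A x) <= c * hnorm (op_shift T z x)) ->
  resolvent_set (op_add T A) z /\
  (opnorm (resolvent (op_add T A) z) <= (d^-1 / (1 - c))%:E)%E.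
Proof.
move=> c01 d0 zT Td Ac; have /andP[c0 c1] := c01.
have c1' : 0 < 1 - c by rewrite subr_gt0.
set S := op_add T A.
have domS : dom S = dom T by exact: dom_op_add.
have shiftS x : op_shift S z x = op_shift T z x + A x.
  by rewrite /op_shift /S /= addrAC.
have shiftSB x y : dom S x -> dom S y ->
    op_shift S z (x - y) = op_shift S z x - op_shift S z y.
  rewrite domS => Tx Ty;
    rewrite !shiftS op_shiftB // (opprD _ (A y)) [RHS]addrACA.
  by rewrite (lin_appB linA); [|exact: TA|exact: TA].
have Sd : bounded_below S z (d * (1 - c)).
  move=> x; rewrite domS => Tx; rewrite shiftS mulrAC -ler_pdivlMr //.
  apply: le_trans (Td _ Tx) _; rewrite ler_pdivlMr //.
  have := ler_hnorm_sub (op_shift T z x + A x) (A x).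
  by rewrite addrK; have := Ac _ Tx; lra.
have bij : set_bij (dom S) setT (op_shift S z).
  split=> //.
    move=> x y; rewrite !inE => Sx Sy xy.
    have Sxy : dom S (x - y) by move: Sx Sy; rewrite domS; exact: lin_domB.
    apply/eqP; rewrite -subr_eq0; apply/eqP/hnorm_eq0/eqP.
    have := Sd _ Sxy; rewrite shiftSB // xy subrr hnorm0.
    by rewrite pmulr_rle0 ?mulr_gt0 // eq_le hnorm_ge0 andbT.
  move=> f _.
  have TB y : dom T (resolvent T z y) by exact: resolvent_dom.
  have [y yf] : exists y, f - A (resolvent T z y) = y.
    apply: contraction_fixpoint c01 _ => x y.
    rewrite opprD addrACA subrr add0r opprK addrC -(lin_appB linA);
      try exact: TA.
    apply: le_trans (Ac _ (lin_domB linT (TB y) (TB x))) _.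
    by rewrite op_shiftB // !op_shiftK // hnorm_distC.
  exists (resolvent T z y); first by rewrite domS.
  by rewrite shiftS op_shiftK // -{1}yf subrK.
have dc : 0 < d * (1 - c) by rewrite mulr_gt0.
have bnd x : hnorm (resolvent S z x) <= (d^-1 / (1 - c)) * hnorm x.
  rewrite -invfM mulrC ler_pdivlMr // mulrC.
  have [_ _ sS] := bij; have [y Sy <-] := sS x I.
  rewrite /resolvent pinvKV ?inE //; first exact: Sd.
  by case: bij.
split; first by split=> //; exists (d^-1 / (1 - c)).
apply: ge_ereal_sup => _ [x /= x1 <-]; rewrite lee_fin.
apply: le_trans (bnd x) _; rewrite ler_piMr // divr_ge0 ?invr_ge0 //.
  exact: ltW d0.
exact: ltW c1'.
Qed.

(** For normal T, this is the passage from a quadratic inequality on the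
    spectrum to the same inequality between norms. If C > b^2, the difference
    of the two sides is C - b^2 times |T x - w x|^2 - r0 |x|^2, both for T and
    for a scalar l, so that the claim says that the complement of a disc
    controls T - w from below. The case C = b^2, in which the disc degenerates
    to a half-plane, is a limit. *)
Lemma normal_quadratic_bound (a b C : R) (z : R[i]) : normal_operator T ->
  b ^+ 2 <= C ->
  (forall l, spectrum T l ->
    a ^+ 2 + b ^+ 2 * (complex.Re l ^+ 2 + complex.Im l ^+ 2) <=
    C * (complex.Re (l - z) ^+ 2 + complex.Im (l - z) ^+ 2)) ->
  forall x, dom T x ->
    a ^+ 2 * hnorm x ^+ 2 + b ^+ 2 * hnorm (T x) ^+ 2 <=
    C * hnorm (op_shift T z x) ^+ 2.
Proof.
move=> normT bC specC x Tx.
suff strict C' : b ^+ 2 < C' -> C <= C' ->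
    a ^+ 2 * hnorm x ^+ 2 + b ^+ 2 * hnorm (T x) ^+ 2 <=
    C' * hnorm (op_shift T z x) ^+ 2.
  set Y := hnorm (op_shift T z x) ^+ 2 in strict *.
  have Y0 : 0 <= Y by exact: sqr_ge0.
  have Y1 : 0 < Y + 1 by rewrite ltr_wpDl.
  apply/ler_addgt0Pr => e e0; have eY : 0 < e / (Y + 1) by rewrite divr_gt0.
  apply: le_trans (strict (C + e / (Y + 1)) _ _) _; [lra|lra|].
  rewrite mulrDl lerD2l mulrAC ler_pdivrMr // ler_pM2l //; lra.
(* The centre w and the squared radius r0 come from completing the square;
   there is nothing to prove when r0 <= 0. *)
move=> {}bC CC'; pose k := C' - b ^+ 2.
have k0 : 0 < k by rewrite subr_gt0.
pose s := C' / k; pose w := s%:C * z.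
pose Z := complex.Re z ^+ 2 + complex.Im z ^+ 2.
pose r0 := s ^+ 2 * Z - (C' * Z - a ^+ 2) / k.
have xE : C' * hnorm (op_shift T z x) ^+ 2 -
    (a ^+ 2 * hnorm x ^+ 2 + b ^+ 2 * hnorm (T x) ^+ 2) =
    k * (hnorm (op_shift T w x) ^+ 2 - r0 * hnorm x ^+ 2).
  rewrite /op_shift !hnorm_sqrB /w -scalerA ipZr !hnormZ_sqr /= -/Z.
  rewrite /r0 /s /k; field; rewrite -/k gt_eqF //.
have lE (l : R[i]) : C' * (complex.Re (l - z) ^+ 2 + complex.Im (l - z) ^+ 2) -
    (a ^+ 2 + b ^+ 2 * (complex.Re l ^+ 2 + complex.Im l ^+ 2)) =
    k * (complex.Re (l - w) ^+ 2 + complex.Im (l - w) ^+ 2 - r0).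
  rewrite /r0 /w /Z /s /k; move: k0; rewrite /k.
  by case: z l {specC Z r0 xE w} => [z1 z2] [l1 l2] k0 /=; field;
    rewrite gt_eqF.
rewrite -subr_ge0 xE pmulr_rge0 // subr_ge0.
have [r0_le|r0_gt] := leP r0 0.
  by apply: le_trans (sqr_ge0 _); rewrite mulr_le0_ge0 ?sqr_ge0.
have r_gt0 : 0 < Num.sqrt r0 by rewrite sqrtr_gt0.
have := normal_bounded_below normT r_gt0 (w := w); move=> /(_ _ _ Tx).
rewrite -[r0 in X in _ -> X]sqr_sqrtr ?(ltW r0_gt) // -exprMn.
rewrite ler_sqr ?nnegrE ?mulr_ge0 ?hnorm_ge0 ?sqrtr_ge0 //; apply => l lw.
apply: contrapT => /specC lz; move: lw.
rewrite sqr_sqrtr ?(ltW r0_gt) //.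
apply/negP; rewrite -leNgt -subr_ge0 -(pmulr_rge0 _ k0) -lE subr_ge0.
by apply: le_trans lz _; rewrite ler_wpM2r // addr_ge0 ?sqr_ge0.
Qed.

End perturbation.

(** * Spectral gaps under relatively bounded perturbations *)

(** Let u = t - l >= 0. By Minkowski's inequality, moving from t to l raises
    the square root of s + b^2 t^2 by at most b u, whereas c (x - t) grows by
    c u >= b u. *)
Lemma weighted_modulus_le {R : realType} (s b c l x t : R) :
  0 <= s -> 0 <= b <= c -> l <= t < x ->
  Num.sqrt (s + b ^+ 2 * t ^+ 2) <= c * (x - t) ->
  s + b ^+ 2 * l ^+ 2 <= c ^+ 2 * (x - l) ^+ 2.
Proof.
move=> s0 /andP[b0 bc] /andP[lt tx].
have r0 : 0 <= s + b ^+ 2 * t ^+ 2 by rewrite addr_ge0 // mulr_ge0 ?sqr_ge0.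
set r := Num.sqrt _ => rc.
have r2 : r ^+ 2 = s + b ^+ 2 * t ^+ 2 by rewrite sqr_sqrtr.
have rge0 : 0 <= r by exact: sqrtr_ge0.
(* As |b t| <= r, one has s + b^2 l^2 = r^2 - 2 b^2 t (t - l) + b^2 (t - l)^2
   <= (r + b (t - l))^2. *)
have br : - (b * t) <= r.
  apply: le_trans (ler_norm _) _; rewrite -ler_sqr ?nnegrE //.
  by rewrite real_normK ?num_real // r2 sqrrN exprMn lerDr.
apply: (@le_trans _ _ ((r + b * (t - l)) ^+ 2)).
  have h : 0 <= b * (t - l) * (r + b * t).
    by rewrite !mulr_ge0 ?subr_ge0 // -lerBlDr sub0r.
  by rewrite sqrrD r2; lra.
have u0 : 0 <= t - l by rewrite subr_ge0.
rewrite -exprMn ler_sqr ?nnegrE ?addr_ge0 ?mulr_ge0 //; last 2 first.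
- exact: le_trans bc.
- lra.
have -> : c * (x - l) = c * (x - t) + c * (t - l) by ring.
by apply: lerD => //; rewrite ler_wpM2r.
Qed.

Unset Implicit Arguments.
Set Strict Implicit.

Theorem theorem3p3 (R : realType) (H : hilbertType R) (T A : operator H)
    (a b gamma1 gamma2 alphaT betaT : R) :
  normal_operator T ->
  linear_operator A ->
  dom T `<=` dom A ->
  0 <= a -> 0 <= b < 1 ->
  (forall x, dom T x ->
     hnorm (A x) ^+ 2 <= a ^+ 2 * hnorm x ^+ 2 + b ^+ 2 * hnorm (T x) ^+ 2) ->
  gamma1 < gamma2 ->
  spectrum T `<=` [set z | gamma1 <= complex.Im z <= gamma2] ->
  alphaT < betaT ->
  [set z | alphaT < complex.Re z < betaT] `<=` resolvent_set T ->
  let gamma := Num.max `|gamma1| `|gamma2| in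
  let sa := Num.sqrt (a ^+ 2 + b ^+ 2 * gamma ^+ 2 + b ^+ 2 * alphaT ^+ 2) in
  let sb := Num.sqrt (a ^+ 2 + b ^+ 2 * gamma ^+ 2 + b ^+ 2 * betaT ^+ 2) in
  let alphaTA := alphaT + sa in
  let betaTA := betaT - sb in
  alphaTA < betaTA ->
  [set z | alphaTA < complex.Re z < betaTA] `<=` resolvent_set (op_add T A) /\
  forall z, alphaTA < complex.Re z < betaTA ->
    (opnorm (resolvent (op_add T A) z) <=
      ((Num.sqrt
          ((Num.min (complex.Re z - alphaT) (betaT - complex.Re z)) ^+ 2 +
           (Num.min 0 (Num.min (gamma2 - complex.Im z)
                               (complex.Im z - gamma1))) ^+ 2))^-1 /
       (1 - Num.max b (Num.max (sa / (complex.Re z - alphaT))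
                               (sb / (betaT - complex.Re z)))))%:E)%E.
Proof.
move=> normT linA TA a0 /andP[b0 b1] Abnd g12 specIm ab specRe
  gamma sa sb alphaTA betaTA ab'.
have linT : linear_operator T by case: normT.
suff main z : alphaTA < complex.Re z < betaTA ->
    resolvent_set (op_add T A) z /\
    (opnorm (resolvent (op_add T A) z) <=
      ((Num.sqrt
          ((Num.min (complex.Re z - alphaT) (betaT - complex.Re z)) ^+ 2 +
           (Num.min 0 (Num.min (gamma2 - complex.Im z)
                               (complex.Im z - gamma1))) ^+ 2))^-1 /
       (1 - Num.max b (Num.max (sa / (complex.Re z - alphaT))
                               (sb / (betaT - complex.Re z)))))%:E)%E.
  by split=> [z /main[]|z /main[]].
set x := complex.Re z; set y := complex.Im z => /andP[zl zr].
have sa0 : 0 <= sa by exact: sqrtr_ge0.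
have sb0 : 0 <= sb by exact: sqrtr_ge0.
have xa : 0 < x - alphaT by move: zl; rewrite /alphaTA; lra.
have xb : 0 < betaT - x by move: zr; rewrite /betaTA; lra.
set m1 := Num.min (x - _) _; set m2 := Num.min 0 _; set c := Num.max b _.
have m1_gt0 : 0 < m1 by rewrite lt_min xa.
have m1a : m1 <= x - alphaT by rewrite ge_min lexx.
have m1b : m1 <= betaT - x by rewrite ge_min lexx orbT.
have m2_le0 : m2 <= 0 by rewrite ge_min lexx.
have d2_gt0 : 0 < m1 ^+ 2 + m2 ^+ 2 by rewrite ltr_wpDr ?sqr_ge0 ?exprn_gt0.
have bc : b <= c by rewrite le_max lexx.
have c0 : 0 <= c by exact: le_trans bc.
have ca : sa <= c * (x - alphaT).
  by rewrite -ler_pdivrMr // /c !le_max lexx !orbT.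
have cb : sb <= c * (betaT - x).
  by rewrite -ler_pdivrMr // /c !le_max lexx !orbT.
have c1 : c < 1.
  rewrite !gt_max b1 !ltr_pdivrMr // !mul1r.
  by move: zl zr; rewrite /alphaTA /betaTA => *; apply/andP; split; lra.
have ReB (u v : R[i]) : complex.Re (u - v) = complex.Re u - complex.Re v.
  by case: u v => [? ?] [? ?].
have ImB (u v : R[i]) : complex.Im (u - v) = complex.Im u - complex.Im v.
  by case: u v => [? ?] [? ?].
(* The spectrum lies in two half-strips, to the left of alphaT and to the
   right of betaT. *)
have specP l : spectrum T l ->
    (complex.Re l <= alphaT \/ betaT <= complex.Re l) /\
    gamma1 <= complex.Im l <= gamma2.
  move=> lT; split; last exact: specIm.
  have [|al] := leP (complex.Re l) alphaT; first by left.
  have [|lb] := leP betaT (complex.Re l); first by right.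
  by exfalso; apply: lT; apply: specRe; rewrite /= al.
have d_gt0 : 0 < Num.sqrt (m1 ^+ 2 + m2 ^+ 2) by rewrite sqrtr_gt0.
have zT : resolvent_set T z.
  by apply: specRe; apply/andP; rewrite -/x -subr_gt0 xa -(subr_gt0 x).
apply: resolvent_set_perturb => //; first by rewrite c0.
  apply: normal_bounded_below => // l.
  rewrite sqr_sqrtr ?(ltW d2_gt0) // ReB ImB -/x -/y => lz.
  apply: contrapT => /specP[lRe /andP[g1l lg2]]; move: lz.
  apply/negP; rewrite -leNgt; apply: lerD.
    by case: lRe => lRe; nra.
  have := m2_le0; rewrite le_eqVlt => /orP[/eqP ->|m2_lt0].
    by rewrite expr0n sqr_ge0.
  have m2E : m2 = Num.min (gamma2 - y) (y - gamma1).
    by move: m2_lt0; rewrite /m2;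
      case: (leP 0 (Num.min (gamma2 - y) _)) => //; rewrite ltxx.
  have : gamma2 - y <= m2 \/ y - gamma1 <= m2.
    by rewrite m2E; case: (leP (gamma2 - y) (y - gamma1)) => _; [left|right].
  by case=> ?; nra.
move=> v Tv.
have hS0 := hnorm_ge0 (op_shift T z v).
rewrite -ler_sqr ?nnegrE ?hnorm_ge0 ?mulr_ge0 // exprMn.
apply: le_trans (Abnd _ Tv) _.
apply: normal_quadratic_bound => // [|l /specP[lRe /andP[g1l lg2]]].
  by rewrite ler_sqr ?nnegrE.
rewrite ReB ImB -/x -/y.
have Imgamma : complex.Im l ^+ 2 <= gamma ^+ 2.
  rewrite -[leLHS]real_normK ?num_real // ler_sqr ?nnegrE //; last first.
    by rewrite le_max normr_ge0.
  rewrite ler_norml; apply/andP; split.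
    rewrite lerNl /gamma le_max; apply/orP; left.
    by apply: le_trans (_ : - gamma1 <= _);
      [rewrite lerN2|rewrite -normrN ler_norm].
  rewrite /gamma le_max; apply/orP; right.
  exact: le_trans lg2 (ler_norm _).
pose s := a ^+ 2 + b ^+ 2 * gamma ^+ 2.
have s0 : 0 <= s.
  by apply: addr_ge0; [|apply: mulr_ge0]; exact: sqr_ge0.
apply: (@le_trans _ _ (s + b ^+ 2 * complex.Re l ^+ 2)).
  rewrite /s; have := ler_wpM2l (sqr_ge0 b) Imgamma; lra.
apply: (@le_trans _ _ (c ^+ 2 * (x - complex.Re l) ^+ 2)); last first.
  by rewrite ler_wpM2l ?sqr_ge0 // -sqrrN opprB lerDl sqr_ge0.
case: lRe => lRe.
  apply: (@weighted_modulus_le _ s b c _ x alphaT) => //.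
    by rewrite b0.
  by rewrite lRe -subr_gt0.
(* The right half-strip is the reflection of the left one. *)
rewrite -(sqrrN (complex.Re l)) -(sqrrN (x - _)).
have -> : - (x - complex.Re l) = - x - - complex.Re l by rewrite opprB addrC
  opprK.
apply: (@weighted_modulus_le _ s b c _ (- x) (- betaT)) => //.
- by rewrite b0.
- by rewrite lerN2 lRe ltrN2 -subr_gt0.
- by rewrite sqrrN opprK (addrC (- x)).
Qed.
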